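(* Let $G=(V,A,c,q)$ be a weighted digraph with nonnegative linear costs $c$ and nonnegative adjacent quadratic costs $q$, let $s\in V$ be a source node and $t\in V\setminus\{s\}$ a target node. Suppose that $G$ contains no improving $\alpha$-cycle. Let $D$ be the output of the Adjacent Quadratic Dijkstra algorithm run on $(V,A,c,q,s)$. Then $\min\{D_a: a\in\delta^-(t)\}$ equals the minimum cost of an $s$-$t$-path in $G$ (both being $+\infty$ if there is no $s$-$t$-path).
   Context: **Graph and costs.** $(V,A)$ is a finite digraph, with $A\subseteq V\times V$ and no self-loops. Each arc $(u,v)\in A$ has a linear cost $c_{uv}\ge 0$. Each pair of consecutive arcs $((u,v),(v,w))\in A\times A$ has a quadratic cost $q_{uvw}=q((u,v),(v,w))\ge 0$. Pairs of arcs that are not consecutive have zero quadratic cost. $\delta^-(u)$ denotes the set of arcs of $A$ entering $u$, i.e. arcs of the form $(v,u)\in A$. The minimum over the empty set is $+\infty$. **Walks and paths.** A walk is a tuple of nodes $(v_0,v_1,\dots,v_k)$ with $(v_{r},v_{r+1})\in A$ for all $0\le r<k$; nodes and arcs may repeat. Its cost (total compounded weight) is $$\mathrm{cost}(v_0,\dots,v_k)=\sum_{r=0}^{k-1}c_{v_rv_{r+1}}+\sum_{r=1}^{k-1}q_{v_{r-1}v_rv_{r+1}}.$$ An $s$-$t$-path is a walk from $s$ to $t$ with no repeated node. **Improving $\alpha$-cycles.** An $\alpha$-cycle is a walk $(u_1,\dots,u_n)$ with $n\ge5$ and $u_2=u_{n-1}$. It is improving if its cost is strictly lower than the cost of the shorter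 walk $(u_1,u_2,u_n)$. **Adjacent Quadratic Dijkstra algorithm** (input $V,A,c,q,s$). An artificial arc $(s,s)$, not belonging to $A$, is used for initialization, with the convention $q_{ssk}=0$ for every $k$ with $(s,k)\in A$. The neighbors of a node $j$ are the nodes $k$ with $(j,k)\in A$. 1. Set $D_a\leftarrow+\infty$ for every $a\in A$; set $D_{(s,s)}\leftarrow 0$ and $Q\leftarrow\{(s,s)\}$. 2. While $Q\neq\emptyset$: - choose $a=(i,j)\in\arg\min\{D_a:a\in Q\}$ (ties broken arbitrarily) and set $Q\leftarrow Q\setminus\{a\}$; - for each neighbor $k$ of $j$: if $D_a+c_{jk}+q_{ijk}<D_{(j,k)}$, then set $D_{(j,k)}\leftarrow D_a+c_{jk}+q_{ijk}$ and $Q\leftarrow Q\cup\{(j,k)\}$. 3. Return $D$. *)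

(* Defs.v *)
From HB Require Import structures.
From mathcomp Require Import all_boot all_order all_algebra.
From mathcomp Require Import constructive_ereal.
Set Implicit Arguments. Unset Strict Implicit. Unset Printing Implicit Defensive.
Import Order.TTheory GRing.Theory Num.Theory.
Local Open Scope ring_scope.
Local Open Scope ereal_scope.

(* Digraphs are given by the arc relation [A] on a finite type [V] of nodes.
   [c u v] is the linear cost of the arc (u,v) and [q u v w] the quadratic cost
   of the consecutive arcs (u,v), (v,w); their values outside arcs, resp.
   consecutive pairs of arcs, are never used. *)

Section Walks.
Variables (R : realDomainType) (V : finType) (A : rel V).
Variables (c : V -> V -> R) (q : V -> V -> V -> R).

Fixpoint linear_cost (p : seq V) : R :=
  match p with
  | u :: ((v :: _) as p') => (c u v + linear_cost p')%R
  | _ => 0%R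
  end.

Fixpoint quadratic_cost (p : seq V) : R :=
  match p with
  | u :: ((v :: w :: _) as p') => (q u v w + quadratic_cost p')%R
  | _ => 0%R
  end.

Definition cost (p : seq V) : R := (linear_cost p + quadratic_cost p)%R.

Definition walk (p : seq V) : bool :=
  if p is u :: p' then path A u p' else false.

(* A walk starting at [s] is represented by its nodes after [s], as in [path];
   its full node sequence is [s :: p]. *)
Definition st_path (s t : V) (p : seq V) : bool :=
  [&& walk (s :: p), last s p == t & uniq (s :: p)].

(* The walk (u1, u2, m_1, ..., m_k, u2, un); it has n = k + 4 nodes, so that
   n >= 5 means that [m] is nonempty. *)
Definition alpha_seq (u1 u2 : V) (m : seq V) (un : V) : seq V :=
  [:: u1, u2 & m ++ [:: u2; un]].

Definition alpha_cycle (u1 u2 : V) (m : seq V) (un : V) : bool :=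
  (m != [::]) && walk (alpha_seq u1 u2 m un).

Definition improving_alpha_cycle (u1 u2 : V) (m : seq V) (un : V) : bool :=
  alpha_cycle u1 u2 m un &&
  (cost (alpha_seq u1 u2 m un) < cost [:: u1; u2; un])%R.

(* The minimum over an empty set of paths is +oo. *)
Definition is_min_path_cost (s t : V) (x : \bar R) : Prop :=
  ((exists2 p, st_path s t p & x = (cost (s :: p))%:E) /\
   (forall p, st_path s t p -> x <= (cost (s :: p))%:E))
  \/ ((forall p, ~~ st_path s t p) /\ x = +oo).

Definition in_arcs (u : V) : {set V * V} := [set a | A a.1 a.2 & a.2 == u].

End Walks.

Section AdjacentQuadraticDijkstra.
Variables (R : realDomainType) (V : finType) (A : rel V).
Variables (c : V -> V -> R) (q : V -> V -> V -> R) (s : V).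

(* A state (D, Q): the labels and the queue. Only the entries of [D] at the arcs
   of [A] and at the artificial arc (s,s) matter; the others remain +oo. *)
Definition aqd_state : Type := ((V * V -> \bar R) * {set V * V})%type.

Definition aqd_init : aqd_state :=
  (fun a => if a == (s, s) then 0 else +oo, [set (s, s)]).

(* [q] with the convention q_{ssk} = 0 for the artificial arc (s,s). *)
Definition aqd_q (i j k : V) : R := if (i, j) == (s, s) then 0%R else q i j k.

Definition aqd_label (D : V * V -> \bar R) (a : V * V) (k : V) : \bar R :=
  D a + (c a.2 k)%:E + (aqd_q a.1 a.2 k)%:E.

Definition aqd_improves (D : V * V -> \bar R) (a b : V * V) : bool :=
  [&& b.1 == a.2, A b.1 b.2 & aqd_label D a b.2 < D b].

(* One iteration of the while loop, with extracted arc [a]. The updates for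
   the various neighbors k of a.2 are done simultaneously: the update for k only
   reads and writes D at (a.2,k), besides reading D at [a], and [a] itself is
   not written when [A] has no self-loop. *)
Definition aqd_relax (st : aqd_state) (a : V * V) : aqd_state :=
  (fun b => if aqd_improves st.1 a b then aqd_label st.1 a b.2 else st.1 b,
   (st.2 :\ a) :|: [set b | aqd_improves st.1 a b]).

(* Nondeterministic: any minimizer may be extracted. *)
Inductive aqd_step (st : aqd_state) : aqd_state -> Prop :=
| AqdStep a : a \in st.2 -> (forall b, b \in st.2 -> st.1 a <= st.1 b) ->
    aqd_step st (aqd_relax st a).

Inductive aqd_reachable : aqd_state -> Prop :=
| AqdInit : aqd_reachable aqd_init
| AqdNext st st' : aqd_reachable st -> aqd_step st st' -> aqd_reachable st'.

Definition aqd_output (D : V * V -> \bar R) : Prop :=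
  aqd_reachable (D, set0).

Section Termination.
Hypothesis c_ge0 : forall u v, A u v -> (0 <= c u v)%R.
Hypothesis q_ge0 : forall u v w, A u v -> A v w -> (0 <= q u v w)%R.

Let is_arc (a : V * V) := (a == (s, s)) || A a.1 a.2.

(* [X] is the set of the arcs extracted so far. *)
Let inv (X : {set V * V}) (st : aqd_state) : Prop :=
  [/\ {in st.2, forall b, is_arc b}, [disjoint X & st.2]
    & {in X & st.2, forall x y, st.1 x <= st.1 y}].

Lemma aqd_label_ge (D : V * V -> \bar R) a k :
  is_arc a -> A a.2 k -> D a <= aqd_label D a k.
Proof.
move=> arc_a Aak; rewrite /aqd_label -addeA -EFinD leeDl// lee_fin addr_ge0//.
  exact: c_ge0.
rewrite /aqd_q -surjective_pairing; case: eqP => // /eqP/negPf a_ss.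
by move: arc_a; rewrite /is_arc a_ss /= => Aa; exact: q_ge0.
Qed.

Lemma aqd_inv_acc X st : inv X st -> Acc (fun y x => aqd_step x y) st.
Proof.
have [n] := ubnP #|~: X|.
elim: n => [|n IHn] in X st *; first by rewrite ltn0.
rewrite ltnS => leX [arcs disj mono]; constructor=> _ [a aQ amin].
have aX : a \notin X by rewrite (disjointFl disj aQ).
apply: (IHn (a |: X)).
  apply: leq_trans leX; apply: proper_card; apply/properP; split.
    by rewrite setCS subsetUr.
  by exists a; rewrite !inE ?aX ?eqxx.
have arc_a := arcs a aQ.
have xa x : x \in a |: X -> st.1 x <= st.1 a.
  by rewrite in_setU1 => /predU1P[->//|xX]; exact: mono.
have nimp x : x \in a |: X -> aqd_improves st.1 a x = false.
  move=> xX; apply/negP => /and3P[/eqP x1 Ax]; apply/negP; rewrite -leNgt.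
  by apply: le_trans (xa x xX) _; apply: aqd_label_ge; rewrite // -x1.
split=> /=.
- move=> b /setUP[/setD1P[_]|]; first exact: arcs.
  by rewrite inE /is_arc => /and3P[_ -> _]; rewrite orbT.
- apply/pred0P => b /=; apply/negP => /andP[bX].
  case/setUP=> [/setD1P[ba bQ]|]; last by rewrite inE nimp.
  by move: bX; rewrite in_setU1 (negPf ba) (disjointFl disj bQ).
- move=> x y xX /setUP yQ; rewrite (nimp x xX); apply: (le_trans (xa x xX)).
  case: ifP => [/and3P[/eqP y1 Ay _]|nimpy].
    by apply: aqd_label_ge; rewrite // -y1.
  case: yQ => [/setD1P[_]|]; first exact: amin.
  by rewrite inE nimpy.
Qed.

(* Every run terminates, whatever the tie-breaking. *)
Lemma aqd_terminates : Acc (fun y x => aqd_step x y) aqd_init.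
Proof.
apply: (@aqd_inv_acc set0); split=> [b| |x y]; last by rewrite inE.
  by rewrite /= inE /is_arc => ->.
by rewrite disjoints_subset sub0set.
Qed.

Lemma aqd_output_exists : exists D, aqd_output D.
Proof.
have run := AqdInit; elim: aqd_terminates run => -[D Q] _ IH run.
have [Q0|[a0 a0Q]] := set_0Vmem Q; first by exists D; rewrite /aqd_output -Q0.
have [a aQ amin] := @Order.TotalTheory.arg_minP _ _ _ a0 (mem Q) D a0Q.
have st : aqd_step (D, Q) (aqd_relax (D, Q) a) by apply: AqdStep.
exact: IH st (AqdNext run st).
Qed.

End Termination.
End AdjacentQuadraticDijkstra.

(* Main.v *)
Require Import Defs.
From HB Require Import structures.
From mathcomp Require Import all_boot all_order all_algebra.
From mathcomp Require Import constructive_ereal.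
From mathcomp Require Import lra.
Set Implicit Arguments. Unset Strict Implicit. Unset Printing Implicit Defensive.
Import Order.TTheory GRing.Theory Num.Theory.
Local Open Scope ring_scope.
Local Open Scope ereal_scope.

(** The algorithm is a shortest-walk computation on the line digraph, whose
    vertices are the arcs: a finite label of an arc is the cost of an actual
    walk from [s] ending with it ([aqd_label_realized]), and once the queue is empty
    all the triangle inequalities hold, so that no walk is cheaper than the
    label of its last arc ([aqd_output_le_cost]). Hence the minimum of the
    labels over the arcs entering [t] is the minimum cost of an [s]-[t]-walk.

    It remains to see that walks are not cheaper than paths ([walk_to_path]).
    Take two occurrences of a repeated node [v]. If the first one starts the
    walk, or the second one ends it, dropping what lies before the second, or
    after the first, does not raise the cost because costs are nonnegative.
    Otherwise the closed part has a predecessor [u] and a successor [w], and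
    [u, v, .., v, w] is an alpha-cycle; since it is not improving, replacing it
    by [u, v, w] does not raise the cost. This surgery keeps the arcs [(u, v)]
    and [(v, w)], so the quadratic costs incurred with the rest of the walk are
    unaffected ([cost_overlap]). *)

(** * Costs of walks, and removal of cycles *)

Section WalkCosts.
Variables (R : realDomainType) (V : finType) (A : rel V).
Variables (c : V -> V -> R) (q : V -> V -> V -> R).
Local Notation cost := (cost c q).

Lemma cost_cons3 u v w p :
  cost [:: u, v, w & p] = (c u v + q u v w + cost [:: v, w & p])%R.
Proof. by rewrite /Defs.cost /=; lra. Qed.

Lemma cost_arc u v : cost [:: u; v] = c u v.
Proof. by rewrite /Defs.cost /= !addr0. Qed.

(** Two walks are glued along a common arc, not a common node: the quadratic
    cost at the junction depends on both arcs there. The shared arc is counted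
    twice on the right. *)
Lemma cost_overlap x u v y :
  (cost (x ++ [:: u, v & y]) + c u v
   = cost (x ++ [:: u; v]) + cost [:: u, v & y])%R.
Proof.
elim: x => [|a x IH]; first by rewrite cost_arc addrC.
case: x IH => [_|b x IH]; first by rewrite /= !cost_cons3 cost_arc; lra.
by case: x IH => [|d x] IH; rewrite /= !(cost_cons3 a); move: IH => /=; lra.
Qed.

Lemma cost_rcons2 s p v w :
  cost (s :: rcons (rcons p v) w)
  = (cost (s :: rcons p v) + (c v w + q (last s p) v w))%R.
Proof.
rewrite -!rcons_cons lastI -!cats1 -!catA /=.
have := cost_overlap (belast s p) (last s p) v [:: w].
by rewrite cost_cons3 cost_arc; lra.
Qed.

Lemma not_uniq_split (z : seq V) :
  ~~ uniq z -> exists x v m y, z = x ++ v :: m ++ v :: y.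
Proof.
elim: z => // a z IH /=; rewrite negb_and negbK => /orP[|/IH].
  by case/splitPr=> m y; exists [::], a, m, y.
by case=> x [v [m [y ->]]]; exists (a :: x), v, m, y.
Qed.

Hypothesis c_ge0 : forall u v, A u v -> (0 <= c u v)%R.
Hypothesis q_ge0 : forall u v w, A u v -> A v w -> (0 <= q u v w)%R.

Lemma cost_behead_le u p : path A u p -> (cost p <= cost (u :: p))%R.
Proof.
case: p => [|v [|w p]] /=; first by [].
  by rewrite andbT cost_arc /Defs.cost /= addr0; exact: c_ge0.
case/and3P=> Auv Avw _; rewrite cost_cons3 lerDr addr_ge0 ?c_ge0//.
exact: q_ge0.
Qed.

Lemma cost_suffix_le x y : sorted A (x ++ y) -> (cost y <= cost (x ++ y))%R.
Proof.
elim: x => //= u x IH xy; apply: le_trans (cost_behead_le xy).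
by apply: IH; exact: path_sorted xy.
Qed.

Lemma cost_ge0 z : sorted A z -> (0 <= cost z)%R.
Proof.
move=> zA; have := @cost_suffix_le z [::]; rewrite cats0 => /(_ zA).
by rewrite {1}/Defs.cost /= addr0.
Qed.

(** The prefix keeps its last arc [(u, v)] so that the cost splits there. *)
Lemma cost_prefix_le x u v y : sorted A (x ++ [:: u, v & y]) ->
  (cost (x ++ [:: u; v]) <= cost (x ++ [:: u, v & y]))%R.
Proof.
move=> xyA; have := cost_overlap x u v y.
suff : (c u v <= cost [:: u, v & y])%R by lra.
have [_] := cat_sorted2 xyA.
case: y {xyA} => [|w y] /=; first by rewrite cost_arc.
case/and3P=> Auv Avw yA; rewrite cost_cons3.
have : (0 <= cost [:: v, w & y])%R by apply: cost_ge0; rewrite /= Avw.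
by have := q_ge0 Auv Avw; lra.
Qed.

Hypothesis A_irr : irreflexive A.
Hypothesis no_improving : forall u1 u2 m un,
  ~~ improving_alpha_cycle A c q u1 u2 m un.

(** The detour contributes exactly the cost of the alpha-cycle
    [u, v, m, v, w]: the arcs [(u, v)] and [(v, w)] survive the shortcut, so both
    walks split by [cost_overlap] into the same outer parts. *)
Lemma cost_alpha_shortcut_le x u v m w y :
  sorted A (x ++ [:: u, v & m ++ [:: v, w & y]]) ->
  (cost (x ++ [:: u, v, w & y])
   <= cost (x ++ [:: u, v & m ++ [:: v, w & y]]))%R.
Proof.
move=> zA; have [_ /= uA] := cat_sorted2 zA.
have walk_alpha : walk A (alpha_seq u v m w).
  by move: uA; rewrite /= !cat_path /= => /and5P[-> -> -> -> _].
(* Without self-loops the closed part is a genuine alpha-cycle. *)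
have m_n0 : m != [::].
  apply/eqP => m0; move: walk_alpha.
  by rewrite m0 /= A_irr andbF.
have := no_improving u v m w; rewrite /improving_alpha_cycle /alpha_cycle m_n0.
rewrite walk_alpha /= -leNgt /alpha_seq.
have := cost_overlap x u v (m ++ [:: v, w & y]).
have := cost_overlap x u v [:: w & y].
have := cost_overlap [:: u, v & m] v w y.
have := cost_overlap [:: u] v w y.
by rewrite /=; lra.
Qed.

(** One step of cycle removal; the case split is on whether the closed part is
    initial, final, or internal. *)
Lemma walk_remove_cycle s p : path A s p -> ~~ uniq (s :: p) ->
  exists p', [/\ (size p' < size p)%N, path A s p', last s p' = last s p
    & (cost (s :: p') <= cost (s :: p))%R].
Proof.
move=> + /not_uniq_split[x [v [m [y]]]].
case: x => [|a x] /[swap] -[-> ->] pA.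
  exists y; split.
  - by rewrite size_cat /= addnS ltnS leq_addl.
  - by move: pA; rewrite cat_path /= => /and3P[].
  - by rewrite last_cat.
  - exact: (@cost_suffix_le (v :: m) (v :: y)).
exists (x ++ v :: y); split.
- by rewrite !size_cat /= size_cat /= ltn_add2l !addnS !ltnS leq_addl.
- by move: pA; rewrite !cat_path /= cat_path /= => /and5P[-> -> _ _ ->].
- by rewrite !last_cat /= last_cat.
- have: sorted A (a :: x ++ v :: m ++ v :: y) by [].
  rewrite -!cat_cons lastI -!cats1 -!catA.
  case: y {pA} => [|w y]; first exact: cost_prefix_le.
  exact: cost_alpha_shortcut_le.
Qed.

Lemma walk_to_path s p : path A s p ->
  exists p', [/\ path A s p', last s p' = last s p, uniq (s :: p')
    & (cost (s :: p') <= cost (s :: p))%R].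
Proof.
have [n] := ubnP (size p); elim: n p => // n IH p; rewrite ltnS => le_pn pA.
have [p_uniq|p_nuniq] := boolP (uniq (s :: p)); first by exists p.
have [p1 [lt_p1 p1A p1_last p1_le]] := walk_remove_cycle pA p_nuniq.
have [p2 [p2A p2_last p2_uniq p2_le]] := IH p1 (leq_trans lt_p1 le_pn) p1A.
by exists p2; split; rewrite ?p2_last//; exact: le_trans p1_le.
Qed.

End WalkCosts.

(** * Labels computed by the algorithm *)

Section Labels.
Variables (R : realDomainType) (V : finType) (A : rel V).
Variables (c : V -> V -> R) (q : V -> V -> V -> R) (s : V).
Hypothesis A_irr : irreflexive A.
Local Notation reachable := (aqd_reachable A c q s).
Local Notation label := (aqd_label c q s).
Local Notation improves := (aqd_improves A c q s).

Lemma aqd_q_arc u v w : A u v -> aqd_q q s u v w = q u v w.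
Proof.
by rewrite /aqd_q; case: eqP => // -[-> ->]; rewrite A_irr.
Qed.

(** The artificial arc is a self-loop, so it is never relaxed. *)
Lemma aqd_source_label st : reachable st -> st.1 (s, s) = 0.
Proof.
elim=> {st} [|st _ _ IH [a _ _]] /=; first by rewrite eqxx.
by rewrite /aqd_improves /= A_irr andbF.
Qed.

(** Extending by [(j, k)] a walk that ends with [(i, j)] adds
    [c j k + q i j k], which is what relaxation adds to the label. The
    artificial arc stands for the trivial walk at [s]. *)
Lemma aqd_label_realized st b : reachable st -> st.1 b != +oo -> b != (s, s) ->
  exists p, [/\ path A s (rcons p b.2), last s p = b.1
    & st.1 b = (cost c q (s :: rcons p b.2))%:E].
Proof.
move=> st_reach; elim: st_reach b => {st} [b|st st' st_reach IH st_step b] /=.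
  by case: (b == _) => //; rewrite eqxx.
case: st_step => a _ _ /=; case: ifP => [|_]; last exact: IH.
case/and3P=> /eqP b1 Ab lt_b _ bs.
have a_fin : st.1 a != +oo.
  by apply: contraTneq lt_b => a_oo; rewrite /label a_oo !addye// -leNgt leey.
case: a b b1 Ab lt_b bs a_fin => i j [_ k] /= -> Ajk _ _ a_fin; rewrite /label /=.
have [[i_s j_s]|a_ns] := eqVneq (i, j) (s, s).
  rewrite {}i_s {}j_s in Ajk *; exists [::].
  by rewrite aqd_source_label// /aqd_q eqxx add0e adde0 /= cost_arc Ajk.
have [p [pA p_last ->]] := IH _ a_fin a_ns.
exists (rcons p j); split; rewrite /= ?last_rcons//.
  by rewrite rcons_path last_rcons pA.
rewrite /= in p_last pA *.
have Aij : A i j by move: pA; rewrite rcons_path p_last => /andP[].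
by rewrite aqd_q_arc// cost_rcons2 p_last -!EFinD addrA.
Qed.

(** Whatever the order of extraction, a lowered label puts its arc back in the
    queue, so an arc outside it has been relaxed with its current label (or
    still has label [+oo]), and the other labels only decrease. *)
Lemma aqd_settled st a k : reachable st -> a \notin st.2 -> A a.2 k ->
  st.1 (a.2, k) <= label st.1 a k.
Proof.
move=> st_reach; elim: st_reach a k => {st} [|st st' st_reach IH [b bQ _]] a k /=.
  by rewrite inE => /negPf a_s _; rewrite /aqd_label a_s !addye// leey.
rewrite !inE negb_or negb_and negbK => /andP[ab a_nimp] Aak.
(* The label of [a] itself did not change, or [a] would be back in the queue. *)
rewrite [leRHS](_ : _ = label st.1 a k); last first.
  by rewrite /aqd_label (negPf a_nimp).
have [a_b|a_nb] := eqVneq a b.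
  by rewrite {}a_b in Aak *; rewrite /aqd_improves /= eqxx Aak /=; case: ltP.
have le_a : st.1 (a.2, k) <= label st.1 a k.
  by apply: IH => //; move: ab; rewrite (negPf a_nb).
case: ifP => // /and3P[_ _ lt_b]; exact: le_trans (ltW lt_b) le_a.
Qed.

(** With an empty queue every arc is settled, and the triangle inequalities add
    up along the walk. *)
Lemma aqd_output_le_cost D p v : aqd_output A c q s D ->
  path A s (rcons p v) -> D (last s p, v) <= (cost c q (s :: rcons p v))%:E.
Proof.
move=> D_out; have settled a k := @aqd_settled _ a k D_out (negbT (in_set0 a)).
elim/last_ind: p v => [|p u IH] v.
  rewrite /= andbT => Asv; have := settled (s, s) v Asv.
  by rewrite /aqd_label (aqd_source_label D_out) add0e /aqd_q eqxx adde0 cost_arc.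
rewrite last_rcons rcons_path last_rcons => /andP[puA Auv].
apply: le_trans (settled (last s p, u) v Auv) _.
have Apu : A (last s p) u by move: puA; rewrite rcons_path => /andP[].
rewrite /aqd_label /= aqd_q_arc// -addeA -EFinD cost_rcons2 [leRHS]EFinD.
by apply: leeD2r; exact: IH.
Qed.

End Labels.

(** * Correctness *)

Theorem proposition2 (R : realDomainType) (V : finType) (A : rel V)
    (c : V -> V -> R) (q : V -> V -> V -> R) (s t : V)
    (A_irr : irreflexive A)
    (c_ge0 : forall u v, A u v -> (0 <= c u v)%R)
    (q_ge0 : forall u v w, A u v -> A v w -> (0 <= q u v w)%R)
    (t_neq_s : t != s)
    (no_improving : forall u1 u2 m un,
      ~~ improving_alpha_cycle A c q u1 u2 m un)
    (D : V * V -> \bar R) (D_output : aqd_output A c q s D) :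
  is_min_path_cost A c q s t (\big[mine/+oo]_(a in in_arcs A t) D a).
Proof.
set x := \big[mine/+oo]_(a in _) _.
have x_le p : st_path A s t p -> x <= (cost c q (s :: p))%:E.
  case/and3P=> pA p_last _.
  case: (lastP p) pA p_last => [_ /=|p' v]; first by rewrite eq_sym (negPf t_neq_s).
  rewrite last_rcons => pA /eqP v_t; move: pA; rewrite {}v_t => pA.
  apply: le_trans (aqd_output_le_cost A_irr D_output pA).
  apply: bigmin_le_cond; rewrite inE /= eqxx andbT.
  by move: pA; rewrite /= rcons_path => /andP[].
have [x_oo|x_fin] := eqVneq x +oo.
  right; split=> // p; apply/negP => /x_le.
  by rewrite x_oo leNgt ltey.
have [//|[a a_in x_a]] : x = +oo \/ exists2 a, a \in in_arcs A t & x = D a.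
  rewrite /x; elim/big_ind: _ => [|y z IHy IHz|a a_in]; first by left.
    by rewrite minEle; case: ifP.
  by right; exists a.
  by move=> x_oo; rewrite x_oo eqxx in x_fin.
have [Aa /eqP a2] : A a.1 a.2 /\ a.2 == t by move: a_in; rewrite inE => /andP.
have a_ns : a != (s, s) by apply: contraTneq Aa => ->; rewrite A_irr.
have Da_fin : D a != +oo by rewrite -x_a.
have [p [pA _ /= Da]] := aqd_label_realized A_irr D_output Da_fin a_ns.
have [p' [p'A p'_last p'_uniq p'_le]] :=
  walk_to_path c_ge0 q_ge0 A_irr no_improving pA.
have p'_st : st_path A s t p'.
  by apply/and3P; split; rewrite // p'_last last_rcons a2.
left; split=> //; exists p' => //.
apply/eqP; rewrite eq_le x_le//= x_a Da lee_fin.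
exact: p'_le.
Qed.
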